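(* Let $b$ be a canonically compactifiable graph over $(X,m)$ such that $m(X)<\infty$. Let $c>0$ be a constant and let $0\neq h\in\ell^2(X,m)$. Then there is a $u\in D(L)$ with $$Lu=he^u-c$$ if and only if $h$ is positive somewhere (i.e. $h(x)>0$ for some $x\in X$).
   Context: $X$ is a countable (finite or countably infinite) set with the discrete topology. A graph on $X$ is a symmetric function $b:X\times X\to[0,\infty)$ vanishing on the diagonal with $\sum_{y\in X}b(x,y)<\infty$ for every $x\in X$. It is connected if for all $x,y\in X$ there are $x_1,\dots,x_n\in X$ with $b(x,x_1)>0,\,b(x_1,x_2)>0,\dots,b(x_n,y)>0$. The measure $m$ is given by a function $m:X\to(0,\infty)$ via $m(A)=\sum_{x\in A}m(x)$, with $m(X)<\infty$. $\ell^p(X,m)$, $1\le p<\infty$, is the space of real-valued functions $f$ on $X$ with $\|f\|_p=(\sum_{x}|f(x)|^pm(x))^{1/p}<\infty$, and $\ell^\infty(X)$ is the space of bounded real-valued functions. $\langle f,g\rangle=\sum_x f(x)g(x)m(x)$. For $u:X\to\mathbb R$ let $\widetilde Q(u)=\frac12\sum_{x,y\in X}b(x,y)(u(x)-u(y))^2\in[0,\infty]$ and $\widetilde D=\{u:\widetilde Q(u)<\infty\}$. $Q$ is the restriction of $\widetilde Q$ to $D(Q)=\widetilde D\cap\ell^2(X,m)$; by polarization, $Q(u,v)=\frac12\sum_{x,y}b(x,y)(u(x)-u(y))(v(x)-v(y))$. The Neumann Laplacian $L$ is the self-adjoint operator on $\ell^2(X,m)$ with $D(L)=\{u\in D(Q):\text{there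 is }f\in\ell^2(X,m)\text{ with }Q(u,v)=\langle f,v\rangle\text{ for all }v\in D(Q)\}$ and $Lu=f$. A connected graph $b$ over $(X,m)$ is called canonically compactifiable if $D(Q)\subseteq\ell^\infty(X)$. *)

(* Defs.v *)
From HB Require Import structures.
From mathcomp Require Import all_boot all_order all_algebra.
From mathcomp Require Import all_classical all_reals all_analysis.

Set Implicit Arguments.
Unset Strict Implicit.
Unset Printing Implicit Defensive.

Import Order.TTheory GRing.Theory Num.Theory.
Import numFieldNormedType.Exports.

Local Open Scope classical_set_scope.
Local Open Scope ring_scope.

(* The sum of an absolutely summable real family.  [esum] is meant for
   nonnegative families, so the positive and negative parts are summed
   separately; for families that are not absolutely summable the value is
   junk. *)
Definition rsum (R : realType) (T : choiceType) (f : T -> R) : R :=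
  fine (\esum_(t in [set: T]) (f^\+ t)%:E)
  - fine (\esum_(t in [set: T]) (f^\- t)%:E).

Section Graphs.
Variables (R : realType) (X : countType).
Implicit Types (b : X -> X -> R) (m u v f : X -> R).

Definition is_graph b : Prop :=
  [/\ forall x y, 0 <= b x y,
      forall x y, b x y = b y x,
      forall x, b x x = 0
    & forall x, (\esum_(y in [set: X]) (b x y)%:E < +oo)%E].

(* Distinct vertices are joined by a chain x, x_1, ..., x_n, y of positive
   edges.  The condition is void for x = y, so that the graph with a single
   vertex is connected. *)
Definition connected_graph b : Prop :=
  forall x y, x != y ->
    exists s : seq X, path (fun z w => 0 < b z w) x (rcons s y).

Definition total_mass m : \bar R := \esum_(x in [set: X]) (m x)%:E.

Definition ell2 m : set (X -> R) :=
  [set u | (\esum_(x in [set: X]) (`|u x| ^+ 2 * m x)%:E < +oo)%E].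

Definition ell_infty : set (X -> R) := [set u | bounded_fun u].

Definition inner m u v : R := rsum (fun x => u x * v x * m x).

Definition energy b u : \bar R :=
  ((2^-1)%:E *
    \esum_(p in [set: X * X]) (b p.1 p.2 * (u p.1 - u p.2) ^+ 2)%:E)%E.

Definition finite_energy b : set (X -> R) := [set u | (energy b u < +oo)%E].

Definition form_dom b m : set (X -> R) := finite_energy b `&` ell2 m.

(* On [form_dom b m] the family below is absolutely summable, by
   Cauchy-Schwarz. *)
Definition form b u v : R :=
  2^-1 * rsum (fun p : X * X =>
    b p.1 p.2 * (u p.1 - u p.2) * (v p.1 - v p.2)).

Definition laplacian_rel b m u f : Prop :=
  [/\ form_dom b m u, ell2 m f
    & forall v, form_dom b m v -> form b u v = inner m f v].

Definition laplacian_dom b m : set (X -> R) :=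
  [set u | exists f, laplacian_rel b m u f].

(* The f related to u is unique, see [laplacianP] and [laplacian_rel_uniq];
   outside [laplacian_dom b m] the value is the junk function 0. *)
Definition laplacian b m u : X -> R :=
  xget (fun=> 0) [set f | laplacian_rel b m u f].

Definition canonically_compactifiable b m : Prop :=
  connected_graph b /\ form_dom b m `<=` ell_infty.

Lemma laplacianP b m u :
  laplacian_dom b m u -> laplacian_rel b m u (laplacian b m u).
Proof. by move=> ex; exact: (xgetPex (fun=> 0) ex). Qed.

Let delta (x : X) : X -> R := fun y => (y == x)%:R.

Let esum_delta (x : X) (F : X -> \bar R) : (forall y, y != x -> F y = 0%E) ->
  (0 <= F x)%E -> \esum_(y in [set: X]) F y = F x.
Proof.
move=> F0 Fx; rewrite -(esum_set1 Fx) [RHS]esum_mkcond; apply: eq_esum => y _.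
case: ifPn => [//|]; rewrite notin_setE /= => /eqP yx; exact: F0.
Qed.

Let delta_dom b m x : is_graph b -> (forall x, 0 < m x) ->
  form_dom b m (delta x).
Proof.
move=> [b0 bC _ bfin] m0; split; last first.
  rewrite /ell2 /= (@esum_delta x) /delta ?eqxx ?ltry//.
    by move=> y /negbTE ->; rewrite normr0 expr0n mul0r.
  by rewrite lee_fin mulr_ge0 ?exprn_ge0// ltW.
rewrite /finite_energy /= /energy lte_mul_pinfty ?lee_fin//.
pose F (p : X * X) : \bar R := (b p.1 p.2 * delta x p.1)%:E.
pose G (p : X * X) : \bar R := (b p.1 p.2 * delta x p.2)%:E.
have F0 p : [set: X * X] p -> (0 <= F p)%E.
  by move=> _; rewrite lee_fin mulr_ge0// ler0n.
have G0 p : [set: X * X] p -> (0 <= G p)%E.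
  by move=> _; rewrite lee_fin mulr_ge0// ler0n.
apply: (@le_lt_trans _ _ (\esum_(p in [set: X * X]) (F p + G p))%E).
  apply: le_esum => -[y z] _ /=; rewrite /F /G -EFinD lee_fin -mulrDr.
  apply: ler_wpM2l => //=; rewrite /delta.
  case: (y == x); case: (z == x);
    by rewrite /= ?subrr ?subr0 ?sub0r ?sqrrN ?expr0n ?expr1n ?addr0 ?add0r
               ?addr_ge0 ?ler01.
have Fval : \esum_(p in [set: X * X]) F p = \esum_(z in [set: X]) (b x z)%:E.
  have -> : [set: X * X] = [set: X] `*`` (fun=> [set: X]).
    by apply/seteqP; split => -[].
  rewrite -(@esum_esum R X X setT (fun=> setT) (fun y z => F (y, z))); last first.
    by move=> *; exact: F0.
  rewrite (@esum_delta x (fun y => \esum_(z in [set: X]) F (y, z))).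
  - by apply: eq_esum => z _; rewrite /F /delta /= eqxx mulr1.
  - move=> y yx; apply: esum1 => z _.
    by rewrite /F /delta /= (negbTE yx) mulr0.
  - by apply: esum_ge0 => z _; exact: F0.
have GF : \esum_(p in [set: X * X]) G p = \esum_(p in [set: X * X]) F p.
  rewrite (@reindex_esum R _ _ setT setT (fun p : X * X => (p.2, p.1))).
    by apply: eq_esum => -[y z] _; rewrite /F /G /= bC.
  split=> //; first by move=> [a c] [a' c'] _ _ [-> ->].
  by move=> [y z] _; exists (z, y).
by rewrite esumD// GF Fval lte_add_pinfty.
Qed.

Let inner_delta m f x : inner m f (delta x) = f x * m x.
Proof.
rewrite /inner /rsum !(@esum_delta x) /delta /= ?lee_fin ?le_max ?lexx ?orbT//.
- rewrite /funrpos /funrneg eqxx mulr1 /=; case: (lerP 0 (f x * m x)) => fm.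
    by rewrite max_r ?oppr_le0// subr0.
  by rewrite max_l ?oppr_ge0 ?ltW// sub0r opprK.
- by move=> y /negbTE yx; rewrite /funrneg yx mulr0 mul0r oppr0 maxxx.
- by move=> y /negbTE yx; rewrite /funrpos yx mulr0 mul0r maxxx.
Qed.

Lemma laplacian_rel_uniq b m u f g :
  is_graph b -> (forall x, 0 < m x) ->
  laplacian_rel b m u f -> laplacian_rel b m u g -> f = g.
Proof.
move=> bG m0 [_ _ uf] [_ _ ug]; apply/funext => x.
have dx := delta_dom x bG m0.
apply: (@mulIf _ (m x)); first by rewrite gt_eqF.
by rewrite -!inner_delta -uf// -ug.
Qed.

End Graphs.

(* Main.v *)
Require Import Defs.
From HB Require Import structures.
From mathcomp Require Import all_boot all_order all_algebra.
From mathcomp Require Import all_classical all_reals all_analysis.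
From mathcomp Require Import finmap ring lra.

(** Necessity is the pairing of the equation with the constant function 1: the
form vanishes on constants, so [h * e^u - c] has mean zero, and it would be
negative everywhere if [h] were nowhere positive.

Sufficiency is variational.  A solution is obtained, up to an additive constant,
by minimizing [energy_functional],
<<
  Phi v = Q v / 2 + c * int v - c * m(X) * ln (int h e^v),
>>
over the [v] in the form domain with [int h e^v > 0].  The functional does not
change when a constant is added to [v]; this normalizes [v o = 0] at a vertex
[o] with [h o > 0], and it lets a minimizer [w] be shifted so that
[int h e^u = c * m(X)], which turns the Euler-Lagrange equation of [w] into
[L u = h e^u - c] ([euler_lagrange], [solution_exists]).

A minimizer exists because of two estimates that rest on the hypothesis that
every function of the form domain is bounded.
- [sup_embedding]: the sup norm is controlled by the form norm.  Otherwise there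
  are [w_n] in the form domain, of form norm tending fast to zero and with
  [sup |w_n|] tending to infinity, and the pointwise supremum of the [|w_n|] is
  an unbounded function of the form domain.
- [poincare]: on functions with [v o = 0] the sup norm is controlled by the
  energy alone.  On a finite set this follows from connectedness by summing
  along paths; the complement of a large finite set has so little mass that its
  share of the l2 norm is absorbed by [sup_embedding].
Hence [Phi] is bounded below and its sublevel sets are bounded in energy and in
the sup norm ([coercive]).  A minimizing sequence is then pointwise bounded, so
it converges pointwise along an ultrafilter; Fatou's lemma passes to the limit
in [Q] and dominated convergence in the two other terms ([minimizer_exists]). *)

Set Implicit Arguments.
Unset Strict Implicit.
Unset Printing Implicit Defensive.

Import Order.TTheory GRing.Theory Num.Theory.
Import numFieldNormedType.Exports.

Local Open Scope classical_set_scope.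
Local Open Scope ring_scope.

(** * Absolutely summable real families *)

Section RealSums.
Variables (R : realType) (T : choiceType).
Implicit Types (f g : T -> R) (a C : R).

Definition rsummable f := summable [set: T] (EFin \o f).

Lemma le_rsummable f g :
  (forall t, `|f t| <= g t) -> rsummable g -> rsummable f.
Proof.
move=> fg; apply: le_lt_trans; apply: le_esum => t _ /=.
by rewrite lee_fin (le_trans (fg t))// ler_norm.
Qed.

Lemma rsummableD f g :
  rsummable f -> rsummable g -> rsummable (fun t => f t + g t).
Proof. exact: summableD. Qed.

Lemma rsummable_esum f : (forall t, 0 <= f t) ->
  rsummable f <-> (\esum_(t in [set: T]) (f t)%:E < +oo)%E.
Proof.
move=> f0; rewrite /rsummable /summable.
by under eq_esum => t _ do rewrite /= ger0_norm//.
Qed.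

(** The inequality [esum (a * f) <= a * esum f], applied to [a] and to [a^-1],
gives both directions. *)
Lemma esumZ a f : 0 < a -> (forall t, 0 <= f t) ->
  \esum_(t in [set: T]) (a * f t)%:E =
  (a%:E * \esum_(t in [set: T]) (f t)%:E)%E.
Proof.
have le b g : 0 < b -> (forall t, 0 <= g t) ->
    (\esum_(t in [set: T]) (b * g t)%:E <=
     b%:E * \esum_(t in [set: T]) (g t)%:E)%E.
  move=> b0 g0; apply: ge_ereal_sup => _ [A fA <-].
  have -> : (\sum_(t \in A) (b * g t)%:E = b%:E * \sum_(t \in A) (g t)%:E)%E.
    case: fA => fA _; rewrite (fsumEFin _ fA) (fsumEFin g fA) -EFinM.
    by rewrite !fsbig_finite//= big_distrr.
  rewrite lee_pmul2l ?lte_fin//; apply: ereal_sup_ubound; by exists A.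
move=> a0 f0; apply/eqP; rewrite eq_le le//=.
have := @le a^-1 (fun t => a * f t); rewrite invr_gt0 => /(_ a0).
have -> : \esum_(t in [set: T]) (a^-1 * (a * f t))%:E
        = \esum_(t in [set: T]) (f t)%:E.
  by apply: eq_esum => t _; rewrite mulrA mulVf ?mul1r// gt_eqF.
move=> H; rewrite -(@lee_pmul2l _ (a^-1)%:E) ?lte_fin ?invr_gt0//.
rewrite muleA -EFinM mulVf ?gt_eqF// mul1e; apply: H => t.
by rewrite mulr_ge0// ltW.
Qed.

Lemma rsummableZ a f : rsummable f -> rsummable (fun t => a * f t).
Proof.
move=> sf; apply: (@le_rsummable _ (fun t => (`|a| + 1) * `|f t|)).
  by move=> t; rewrite normrM ler_wpM2r// lerDl.
apply/rsummable_esum => [t|]; first by rewrite mulr_ge0.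
by rewrite esumZ// ?ltr_wpDl// lte_mul_pinfty// lee_fin.
Qed.

Lemma rsummableN f : rsummable f -> rsummable (fun t => - f t).
Proof.
by move=> /(rsummableZ (-1)); under [X in rsummable X]eq_fun do rewrite mulN1r.
Qed.

Lemma rsummableB f g :
  rsummable f -> rsummable g -> rsummable (fun t => f t - g t).
Proof. by move=> sf /rsummableN; exact: rsummableD. Qed.

Lemma rsummable_norm f : rsummable f -> rsummable (fun t => `|f t|).
Proof.
by rewrite /rsummable /summable/=; under eq_esum do rewrite /= -normr_id.
Qed.

(** The value of [rsum] can be computed from any decomposition into nonnegative
summable families in place of the positive and negative parts; additivity of
[rsum] reduces to that of [esum] by this independence. *)
Lemma rsum_diff f g : rsummable f -> rsummable g ->
  (forall t, 0 <= f t) -> (forall t, 0 <= g t) ->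
  rsum (fun t => f t - g t) =
  fine (\esum_(t in [set: T]) (f t)%:E) - fine (\esum_(t in [set: T]) (g t)%:E).
Proof.
move=> sf sg f0 g0.
have fin k : rsummable k -> (forall t, 0 <= k t) ->
    \esum_(t in [set: T]) (k t)%:E \is a fin_num.
  move=> sk k0; have k_ge0 : (0 <= \esum_(t in [set: T]) (k t)%:E)%E.
    by apply: esum_ge0 => t _; rewrite lee_fin.
  by rewrite (ge0_fin_numE k_ge0); exact: (rsummable_esum k0).1 sk.
have sd := rsummableB sf sg.
have -> : rsum (fun t => f t - g t) =
    fine (\esum_(t in [set: T]) (((EFin \o f) \- (EFin \o g))%E^\+ t)%E
        - \esum_(t in [set: T]) (((EFin \o f) \- (EFin \o g))%E^\- t)%E)%E.
  rewrite /rsum -fineB; first last.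
  - apply: fin => [|t]; last by rewrite le_max lexx orbT.
    apply: le_rsummable (rsummable_norm sd) => t.
    rewrite ger0_norm ?le_max ?lexx ?orbT//.
    by rewrite ge_max normr_ge0 ler_normr lexx orbT.
  - apply: fin => [|t]; last by rewrite le_max lexx orbT.
    apply: le_rsummable (rsummable_norm sd) => t.
    by rewrite ger0_norm ?le_max ?lexx ?orbT// ge_max normr_ge0 ler_norm.
  have -> : ((EFin \o f) \- (EFin \o g))%E = EFin \o (f \- g)%R by [].
  by rewrite funerpos funerneg.
rewrite esumB//; try by move=> t _; rewrite /= lee_fin.
by rewrite fineB//; apply: fin.
Qed.

Lemma rsum0 : rsum (fun _ : T => 0 : R) = 0.
Proof.
by rewrite /rsum !esum1 ?subrr// => t _;
  rewrite /funrneg /funrpos ?oppr0 maxxx.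
Qed.

Lemma rsum_ge0E f : rsummable f -> (forall t, 0 <= f t) ->
  (rsum f)%:E = \esum_(t in [set: T]) (f t)%:E.
Proof.
move=> sf f0.
have s0 : rsummable (fun _ : T => 0).
  by apply: le_rsummable sf => t; rewrite normr0.
have -> : f = (fun t => f t - 0) by apply/funext => t; rewrite subr0.
rewrite rsum_diff// [X in _ - fine X]esum1// subr0 fineK.
  by apply: eq_esum => t _; rewrite subr0.
rewrite ge0_fin_numE ?(proj1 (rsummable_esum f0))//.
by apply: esum_ge0 => t _; rewrite lee_fin.
Qed.

Lemma rsum_posneg f : rsummable f ->
  exists g h : T -> R, [/\ rsummable g, rsummable h,
    forall t, 0 <= g t, forall t, 0 <= h t & forall t, f t = g t - h t].
Proof.
move=> sf; exists f^\+, f^\-; split.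
- apply: le_rsummable (rsummable_norm sf) => t.
  by rewrite ger0_norm ?funrpos_ge0// ge_max normr_ge0 ler_norm.
- apply: le_rsummable (rsummable_norm sf) => t.
  by rewrite ger0_norm ?funrneg_ge0// ge_max normr_ge0 ler_normr lexx orbT.
- exact: funrpos_ge0.
- exact: funrneg_ge0.
- by move=> t; rewrite -[in LHS](funrposBneg f).
Qed.

Lemma rsumB_ge0 f g : rsummable f -> rsummable g ->
  (forall t, 0 <= f t) -> (forall t, 0 <= g t) ->
  rsum (fun t => f t - g t) = rsum f - rsum g.
Proof.
move=> sf sg f0 g0; rewrite rsum_diff//.
by rewrite -rsum_ge0E// -rsum_ge0E.
Qed.

Lemma rsumD_ge0 f g : rsummable f -> rsummable g ->
  (forall t, 0 <= f t) -> (forall t, 0 <= g t) ->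
  rsum (fun t => f t + g t) = rsum f + rsum g.
Proof.
move=> sf sg f0 g0; apply: EFin_inj.
rewrite [RHS]EFinD (rsum_ge0E sf)// (rsum_ge0E sg)//.
rewrite rsum_ge0E; first by rewrite -esumD// => t _; rewrite lee_fin.
- exact: rsummableD.
- by move=> t; rewrite addr_ge0.
Qed.

Lemma rsumD f g : rsummable f -> rsummable g ->
  rsum (fun t => f t + g t) = rsum f + rsum g.
Proof.
move=> /rsum_posneg[f1 [f2 [sf1 sf2 f10 f20 fE]]].
move=> /rsum_posneg[g1 [g2 [sg1 sg2 g10 g20 gE]]].
rewrite (funext fE) (funext gE).
have -> : (fun t => f1 t - f2 t + (g1 t - g2 t)) =
          (fun t => (f1 t + g1 t) - (f2 t + g2 t)).
  by apply/funext => t; ring.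
rewrite (rsumB_ge0 (rsummableD sf1 sg1) (rsummableD sf2 sg2)); last 2 first.
- by move=> t; rewrite addr_ge0.
- by move=> t; rewrite addr_ge0.
rewrite (rsumD_ge0 sf1)// (rsumD_ge0 sf2)// (rsumB_ge0 sf1)// (rsumB_ge0 sg1)//.
by ring.
Qed.

Lemma rsumN f : rsum (fun t => - f t) = - rsum f.
Proof.
by rewrite /rsum (funrposN f) (funrnegN f); ring.
Qed.

Lemma rsumZ a f : rsummable f -> rsum (fun t => a * f t) = a * rsum f.
Proof.
have pos b g : 0 < b -> rsummable g -> rsum (fun t => b * g t) = b * rsum g.
  move=> b0 /rsum_posneg[g1 [g2 [sg1 sg2 g10 g20 gE]]].
  rewrite (funext gE).
  have -> : (fun t => b * (g1 t - g2 t)) = (fun t => b * g1 t - b * g2 t).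
    by apply/funext => t; ring.
  rewrite (rsumB_ge0 sg1)// rsumB_ge0; last 4 first.
  - exact: rsummableZ.
  - exact: rsummableZ.
  - by move=> t; rewrite mulr_ge0// ltW.
  - by move=> t; rewrite mulr_ge0// ltW.
  rewrite mulrBr; congr (_ - _); apply: EFin_inj; rewrite EFinM.
    rewrite (rsum_ge0E sg1)// rsum_ge0E ?esumZ//; first exact: rsummableZ.
    by move=> t; rewrite mulr_ge0// ltW.
  rewrite (rsum_ge0E sg2)// rsum_ge0E ?esumZ//; first exact: rsummableZ.
  by move=> t; rewrite mulr_ge0// ltW.
move=> sf; case: (ltgtP a 0) => [a0|a0|->]; last 2 first.
- exact: pos.
- by under [X in rsum X]eq_fun do rewrite mul0r; rewrite rsum0 mul0r.
have -> : (fun t => a * f t) = (fun t => - ((- a) * f t)).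
  by apply/funext => t; ring.
by rewrite rsumN pos// ?oppr_gt0//; ring.
Qed.

Lemma rsumB f g : rsummable f -> rsummable g ->
  rsum (fun t => f t - g t) = rsum f - rsum g.
Proof. by move=> sf sg; rewrite rsumD ?rsumN//; exact: rsummableN. Qed.

Lemma rsum_ge0 f : (forall t, 0 <= f t) -> 0 <= rsum f.
Proof.
move=> f0; rewrite /rsum [X in _ - fine X]esum1 ?subr0 ?fine_ge0//.
  by apply: esum_ge0 => t _; rewrite lee_fin funrpos_ge0.
by move=> t _; rewrite /funrneg max_r// oppr_le0.
Qed.

Lemma ler_rsum f g : rsummable f -> rsummable g -> (forall t, f t <= g t) ->
  rsum f <= rsum g.
Proof.
move=> sf sg fg; rewrite -subr_ge0 -rsumB// rsum_ge0// => t.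
by rewrite subr_ge0.
Qed.

Lemma ler_norm_rsum f g : rsummable g -> (forall t, `|f t| <= g t) ->
  `|rsum f| <= rsum g.
Proof.
move=> sg fg; have sf := le_rsummable fg sg.
rewrite ler_norml -rsumN; apply/andP; split; apply: ler_rsum => //.
- exact: rsummableN.
- by move=> t; have := fg t; rewrite ler_norml => /andP[].
- by move=> t; have := fg t; rewrite ler_norml => /andP[].
Qed.

Lemma rsum_le_of_fsum f C : (forall t, 0 <= f t) ->
  (forall A : {fset T}, \sum_(t <- A) f t <= C) ->
  rsummable f /\ rsum f <= C.
Proof.
move=> f0 fC.
have le : (\esum_(t in [set: T]) (f t)%:E <= C%:E)%E.
  apply: ge_ereal_sup => _ [A [fA _] <-].
  by rewrite fsumEFin// lee_fin fsbig_finite//= fC.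
have sf : rsummable f.
  by apply/rsummable_esum => //; exact: le_lt_trans le (ltry _).
by split => //; rewrite -lee_fin rsum_ge0E.
Qed.

Lemma fsum_le_rsum f (A : {fset T}) : (forall t, 0 <= f t) -> rsummable f ->
  \sum_(t <- A) f t <= rsum f.
Proof.
move=> f0 sf; rewrite -lee_fin rsum_ge0E//; apply: esum_ge.
exists [set` A]; first by split.
by rewrite fsumEFin// fsbig_finite//= set_fsetK.
Qed.

Lemma term_le_rsum f t : (forall t, 0 <= f t) -> rsummable f -> f t <= rsum f.
Proof.
move=> f0 sf; have := fsum_le_rsum [fset t]%fset f0 sf.
by rewrite big_seq_fset1.
Qed.

Lemma rsummable_restr f (A : {fset T}) :
  rsummable (fun t => f t * (t \in A)%:R).
Proof.
suff fsB (B : {fset T}) :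
    \sum_(t <- B) `|f t * (t \in A)%:R| <= \sum_(t <- A) `|f t|.
  have [] := @rsum_le_of_fsum (fun t => `|f t * (t \in A)%:R|) _ _ fsB => //.
  by move=> + _; apply: le_rsummable => t.
have -> : \sum_(t <- B) `|f t * (t \in A)%:R| =
          \sum_(t <- [fset t in B | t \in A]%fset) `|f t|.
  rewrite big_fset /= [in RHS]big_mkcond /=; apply: eq_bigr => t _.
  by case: (t \in A); rewrite ?mulr1 ?mulr0 ?normr0.
have sub : ([fset t in B | t \in A] `<=` A)%fset.
  by apply/fsubsetP => t; rewrite !inE => /andP[].
rewrite [leRHS](big_fsetID _ (mem B))/=.
have -> : [fset t in A | t \in B]%fset = [fset t in B | t \in A]%fset.
  by apply/fsetP => t; rewrite !inE andbC.
by rewrite lerDl sumr_ge0.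
Qed.

Lemma rsum_restr f (A : {fset T}) : (forall t, 0 <= f t) ->
  \sum_(t <- A) f t <= rsum (fun t => f t * (t \in A)%:R).
Proof.
move=> f0; have -> : \sum_(t <- A) f t = \sum_(t <- A) f t * (t \in A)%:R.
  by rewrite big_seq [RHS]big_seq; apply: eq_bigr => t ->; rewrite mulr1.
apply: fsum_le_rsum => [t|]; last exact: rsummable_restr.
by rewrite mulr_ge0.
Qed.

Lemma rsum_tail f e : (forall t, 0 <= f t) -> rsummable f -> 0 < e ->
  exists A : {fset T}, rsum (fun t => f t * (t \notin A)%:R) <= e.
Proof.
move=> f0 sf e0; apply: contrapT => /forallNP nA.
have fsA (A : {fset T}) : \sum_(t <- A) f t <= rsum f - e.
  apply: le_trans (rsum_restr A f0) _.
  have /negP := nA A; rewrite -ltNge => /ltW.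
  have -> : (fun t => f t * (t \notin A)%:R) =
            (fun t => f t - f t * (t \in A)%:R).
    apply/funext => t.
    by case: (t \in A); rewrite /= ?mulr1 ?mulr0 ?subrr ?subr0.
  rewrite rsumB//; last exact: rsummable_restr.
  by lra.
have [_] := rsum_le_of_fsum f0 fsA.
by lra.
Qed.

Section Limits.
Context {I : Type} {F : set_system I} {FF : ProperFilter F}.
Implicit Types (u : I -> T -> R).

(** Fatou's lemma: each finite partial sum of the limit is a limit of finite
partial sums, and these are bounded by [C].  The filter is arbitrary because it
will be an ultrafilter. *)
Lemma rsum_fatou u f C : (\forall i \near F, forall t, 0 <= u i t) ->
  (forall t, u i t @[i --> F] --> f t) ->
  (\forall i \near F, rsummable (u i) /\ rsum (u i) <= C) ->
  rsummable f /\ rsum f <= C.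
Proof.
move=> u0 uf uC; apply: rsum_le_of_fsum => [t|A].
  apply: (cvgr_to_ge (uf t)); near=> i.
  by have : forall t, 0 <= u i t by near: i.
have usum : (\sum_(t <- A) u i t) @[i --> F] --> \sum_(t <- A) f t.
  by apply: cvg_big => [|t _]; [exact: add_continuous|exact: uf].
apply: (cvgr_to_le usum).
near=> i; have [si] : rsummable (u i) /\ rsum (u i) <= C by near: i.
apply: le_trans; apply: fsum_le_rsum => //; by near: i.
Unshelve. all: by end_near. Qed.

(** Dominated convergence: outside a finite set the dominating family has small
sum, and on a finite set pointwise convergence is uniform. *)
Lemma rsum_dominated u f g : rsummable g ->
  (\forall i \near F, forall t, `|u i t| <= g t) ->
  (forall t, u i t @[i --> F] --> f t) ->
  rsum (u i) @[i --> F] --> rsum f.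
Proof.
move=> sg ug uf.
have fg t : `|f t| <= g t.
  apply: (cvgr_to_le (cvg_norm (uf t))); near=> i.
  by have : forall t, `|u i t| <= g t by near: i.
have g0 t : 0 <= g t by apply: le_trans (fg t).
have sf := le_rsummable fg sg.
apply/cvgrPdist_le => e e0.
have e4 : 0 < e / 4 by rewrite divr_gt0.
have [A tailA] := rsum_tail g0 sg e4.
(* [d] is chosen so that [d] times the cardinality of [A] is at most [e / 4] *)
pose one (t : T) := (1 : R) * (t \in A)%:R.
have sone : rsummable one by exact: rsummable_restr.
have one0 : 0 <= rsum one by apply: rsum_ge0 => t; rewrite mulr_ge0.
pose d := e / 4 / (1 + rsum one).
have d0 : 0 < d by rewrite divr_gt0// ltr_pwDl.
have dE : d * (1 + rsum one) = e / 4 by rewrite /d divfK// gt_eqF// ltr_pwDl.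
clearbody d.
have nearA : \forall i \near F, forall t, t \in A -> `|f t - u i t| <= d.
  apply: filterS (@filter_bigI _ _ A
    (fun t => [set i | `|f t - u i t| <= d]) F _ _).
    by move=> i H t tA; exact: H.
  by move=> t _; move/cvgrPdist_le : (uf t) => /(_ d d0).
near=> i.
have ui : forall t, `|u i t| <= g t by near: i.
have uA : forall t, t \in A -> `|f t - u i t| <= d by near: i.
have sui := le_rsummable ui sg.
have st : rsummable (fun t => g t * (t \notin A)%:R).
  apply: le_rsummable sg => t; rewrite ger0_norm ?mulr_ge0//.
  by rewrite ler_piMr// lern1 leq_b1.
rewrite -rsumB//.
apply: le_trans (@ler_norm_rsum _
  (fun t => d * one t + 2 * (g t * (t \notin A)%:R)) _ _) _.
- by apply: rsummableD; apply: rsummableZ.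
- move=> t; rewrite /one; case: (boolP (t \in A)) => tA /=.
    by rewrite !mulr1 !mulr0 addr0; exact: uA.
  rewrite !mulr0 add0r mulr1; have := ler_normB (f t) (u i t).
  by have := fg t; have := ui t; lra.
rewrite (rsumD (rsummableZ d sone) (rsummableZ 2 st)).
rewrite (rsumZ d sone) (rsumZ 2 st).
by move: dE tailA; rewrite mulrDr mulr1; lra.
Unshelve. all: by end_near. Qed.

End Limits.

End RealSums.

(** * The form domain *)

(* Unqualified, this name would refer to sesquilinear forms. *)
Local Notation form := Defs.form.

Section FormDomain.
Variables (R : realType) (X : countType) (b : X -> X -> R) (m : X -> R).
Implicit Types (u v w : X -> R) (a t : R).
Hypothesis bG : is_graph b.
Hypothesis m_gt0 : forall x, 0 < m x.

Definition edge_term u v (p : X * X) : R :=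
  b p.1 p.2 * (u p.1 - u p.2) * (v p.1 - v p.2).

Definition sqnorm u : R := rsum (fun x => u x ^+ 2 * m x).

Let b_ge0 x y : 0 <= b x y. Proof. by case: bG. Qed.

Lemma edge_term_ge0 u p : 0 <= edge_term u u p.
Proof. by rewrite /edge_term -mulrA mulr_ge0// -expr2 sqr_ge0. Qed.

Lemma sqterm_ge0 u x : 0 <= u x ^+ 2 * m x.
Proof. by rewrite mulr_ge0 ?sqr_ge0// ltW. Qed.

Lemma finite_energyP u : finite_energy b u <-> rsummable (edge_term u u).
Proof.
rewrite rsummable_esum; last exact: edge_term_ge0.
have -> : \esum_(p in [set: X * X]) (edge_term u u p)%:E =
    \esum_(p in [set: X * X]) (b p.1 p.2 * (u p.1 - u p.2) ^+ 2)%:E.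
  by apply: eq_esum => p _; rewrite /edge_term expr2 mulrA.
rewrite /finite_energy /= /energy; split; last first.
  by move=> H; rewrite lte_mul_pinfty// lee_fin.
rewrite !ltey; apply: contra => /eqP ->.
by rewrite gt0_muley// lte_fin.
Qed.

Lemma ell2P u : ell2 m u <-> rsummable (fun x => u x ^+ 2 * m x).
Proof.
rewrite rsummable_esum; last exact: sqterm_ge0.
rewrite /ell2 /=; have -> // : \esum_(x in [set: X]) (`|u x| ^+ 2 * m x)%:E =
  \esum_(x in [set: X]) (u x ^+ 2 * m x)%:E.
by apply: eq_esum => x _; rewrite real_normK ?num_real.
Qed.

Lemma form_domP u : form_dom b m u <->
  rsummable (edge_term u u) /\ rsummable (fun x => u x ^+ 2 * m x).
Proof.
split=> -[du nu]; split.
- exact: (finite_energyP u).1 du.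
- exact: (ell2P u).1 nu.
- exact: (finite_energyP u).2 du.
- exact: (ell2P u).2 nu.
Qed.

Lemma form_ge0 u : 0 <= form b u u.
Proof.
rewrite /form mulr_ge0 ?invr_ge0//.
by apply: rsum_ge0 => p; exact: edge_term_ge0.
Qed.

Lemma sqnorm_ge0 u : 0 <= sqnorm u.
Proof. by apply: rsum_ge0 => x; exact: sqterm_ge0. Qed.

(** Twice a product of differences is at most the sum of their squares. *)
Lemma form_dom_edge u v : form_dom b m u -> form_dom b m v ->
  rsummable (edge_term u v).
Proof.
move=> /form_domP[su _] /form_domP[sv _].
apply: le_rsummable (rsummableD su sv) => p.
rewrite /edge_term -!mulrA normrM (ger0_norm (b_ge0 _ _)) -mulrDr.
rewrite ler_wpM2l//; move: (_ - _) (_ - _) => r s.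
rewrite ler_norml; apply/andP; split; nra.
Qed.

Lemma form_domD a u v : form_dom b m u -> form_dom b m v ->
  form_dom b m (fun x => u x + a * v x).
Proof.
move=> du dv; have suv := form_dom_edge du dv.
move: du dv => /form_domP[su nu] /form_domP[sv nv]; apply/form_domP; split.
  have := rsummableD su (rsummableD (rsummableZ (2 * a) suv)
    (rsummableZ (a ^+ 2) sv)).
  apply: le_rsummable => p; rewrite ger0_norm ?edge_term_ge0//.
  rewrite [leRHS](_ : _ = edge_term (fun x => u x + a * v x)
    (fun x => u x + a * v x) p)//.
  by rewrite /edge_term; ring.
have := rsummableD (rsummableZ 2 nu) (rsummableZ (2 * a ^+ 2) nv).
apply: le_rsummable => x.
rewrite ger0_norm; last exact: (sqterm_ge0 (fun x => u x + a * v x)).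
rewrite [leRHS](_ : _ = (2 * u x ^+ 2 + 2 * a ^+ 2 * v x ^+ 2) * m x);
  last by ring.
by rewrite ler_wpM2r ?(ltW (m_gt0 _))//; have := sqr_ge0 (u x - a * v x); nra.
Qed.

Lemma form_expand a u v : form_dom b m u -> form_dom b m v ->
  form b (fun x => u x + a * v x) (fun x => u x + a * v x) =
  form b u u + 2 * a * form b u v + a ^+ 2 * form b v v.
Proof.
move=> du dv; have suv := form_dom_edge du dv.
move: du dv => /form_domP[su nu] /form_domP[sv nv].
rewrite /form -/(edge_term _ _) -/(edge_term _ _) -/(edge_term u v).
have -> : (fun p : X * X =>
      b p.1 p.2 * (u p.1 + a * v p.1 - (u p.2 + a * v p.2))
      * (u p.1 + a * v p.1 - (u p.2 + a * v p.2))) =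
    (fun p => edge_term u u p + (2 * a * edge_term u v p
       + a ^+ 2 * edge_term v v p)).
  by apply/funext => p; rewrite /edge_term; ring.
have s1 := rsummableZ (2 * a) suv; have s2 := rsummableZ (a ^+ 2) sv.
rewrite (rsumD su (rsummableD s1 s2)) (rsumD s1 s2).
rewrite (rsumZ _ suv) (rsumZ _ sv) /edge_term; ring.
Qed.

Lemma form_cst_l t u v : form b (fun x => u x + t) v = form b u v.
Proof.
rewrite /form; congr (_ * rsum _); apply/funext => p.
by congr (_ * _ * _); ring.
Qed.

Lemma form_cst t : form b (fun=> t) (fun=> t) = 0.
Proof.
rewrite /form [X in rsum X](_ : _ = fun=> 0) ?rsum0 ?mulr0//.
by apply/funext => p; rewrite subrr !mulr0.
Qed.

Lemma form_scale a u : form_dom b m u ->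
  form b (fun x => a * u x) (fun x => a * u x) = a ^+ 2 * form b u u.
Proof.
move=> /form_domP[su _].
rewrite /form -/(edge_term u u) mulrCA -(rsumZ _ su); congr (_ * rsum _).
by apply/funext => p; rewrite /edge_term; ring.
Qed.

Lemma sqnorm_scale a u : form_dom b m u ->
  sqnorm (fun x => a * u x) = a ^+ 2 * sqnorm u.
Proof.
move=> /form_domP[_ nu]; rewrite /sqnorm -(rsumZ _ nu); congr rsum.
by apply/funext => x; ring.
Qed.

Lemma form_dom0 : form_dom b m (fun=> 0).
Proof.
have s0 (T : choiceType) : rsummable (fun _ : T => 0 : R).
  by apply/rsummable_esum => //; rewrite esum1 ?ltry.
apply/form_domP; split.
  by apply: le_rsummable (s0 _) => p; rewrite /edge_term subrr !mulr0 normr0.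
by apply: le_rsummable (s0 _) => x; rewrite expr0n mul0r normr0.
Qed.

Lemma form_domZ a u : form_dom b m u -> form_dom b m (fun x => a * u x).
Proof.
move=> du; have := form_domD a form_dom0 du.
by under [X in form_dom b m X]eq_fun do rewrite add0r.
Qed.

Lemma edge_le_form u x y : form_dom b m u ->
  b x y * (u x - u y) ^+ 2 <= 2 * form b u u.
Proof.
move=> /form_domP[su _]; rewrite /form mulVKf ?pnatr_eq0//.
have := term_le_rsum (x, y) (edge_term_ge0 u) su.
by rewrite {1}/edge_term /= expr2 mulrA.
Qed.

Lemma sqterm_le_sqnorm u x : form_dom b m u -> u x ^+ 2 * m x <= sqnorm u.
Proof.
by move=> /form_domP[_]; apply: (term_le_rsum x) => {}x; exact: sqterm_ge0.
Qed.

(** The energy of the indicator of [x0] is at most the total weight of the edges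
at [x0]. *)
Lemma form_dom_indic x0 : form_dom b m (fun x => (x == x0)%:R).
Proof.
have [_ bC _ bfin] := bG.
apply/form_domP; split; last first.
  apply: le_rsummable (rsummable_restr m [fset x0]%fset) => x.
  rewrite !inE ger0_norm; last by rewrite mulr_ge0 ?sqr_ge0 ?(ltW (m_gt0 _)).
  by case: (x == x0); rewrite ?expr1n ?expr0n ?mul0r ?mulr0 ?mul1r ?mulr1.
pose G (p : X * X) : R := (p.1 == x0)%:R * b p.1 p.2.
have G0 p : 0 <= G p by rewrite mulr_ge0.
have sG : rsummable G.
  apply/rsummable_esum => //.
  have -> : [set: X * X] = [set: X] `*`` (fun=> [set: X]).
    by apply/seteqP; split => -[].
  rewrite -(@esum_esum R X X setT (fun=> setT) (fun x y => (G (x, y))%:E));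
    last by move=> *; rewrite lee_fin.
  rewrite (esumID [set x0]); last first.
    by move=> x _; apply: esum_ge0 => y _; rewrite lee_fin.
  rewrite setTI esum_set1; last by apply: esum_ge0 => y _; rewrite lee_fin.
  rewrite [X in (_ + X)%E]esum1 ?adde0; last first.
    move=> x [_ /eqP xx0]; apply: esum1 => y _.
    by rewrite /G /= (negbTE xx0) mul0r.
  by under eq_esum do rewrite /G /= eqxx mul1r.
have sG' : rsummable (fun p : X * X => G (p.2, p.1)).
  apply/rsummable_esum => //; move/rsummable_esum : sG => /(_ G0).
  rewrite (@reindex_esum R _ _ setT setT (fun p : X * X => (p.2, p.1)))//.
  split=> //; first by move=> [? ?] [? ?] _ _ [-> ->].
  by move=> [y z] _; exists (z, y).
apply: le_rsummable (rsummableD sG sG') => -[x y].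
rewrite ger0_norm ?edge_term_ge0// /edge_term /G /= (bC y x) -mulrDl.
rewrite -mulrA [leRHS]mulrC ler_wpM2l//.
by case: (x == x0); case: (y == x0);
  rewrite /= ?subrr ?subr0 ?sub0r ?mulrNN ?mulr1 ?mulr0 ?addr0 ?add0r//
          ?ler0n// ?addr_ge0.
Qed.

(** The form and the squared norm are sums of nonnegative continuous functions
of finitely many values, so both are lower semicontinuous for pointwise
convergence. *)
Lemma form_dom_limit (I : Type) (F : set_system I) (v : I -> X -> R) w
    (q N : R) :
  ProperFilter F ->
  (\forall i \near F,
     [/\ form_dom b m (v i), form b (v i) (v i) <= q & sqnorm (v i) <= N]) ->
  (forall x, v i x @[i --> F] --> w x) ->
  form_dom b m w /\ form b w w <= q.
Proof.
move=> FF dv vw.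
have [sw wq] : rsummable (edge_term w w) /\ rsum (edge_term w w) <= 2 * q.
  apply: (@rsum_fatou R _ _ F _ (fun i => edge_term (v i) (v i))).
  - by near=> i => p; exact: edge_term_ge0.
  - move=> [x y]; rewrite /edge_term /=.
    by apply: cvgM; [apply: cvgM; [exact: cvg_cst|]|]; apply: cvgB.
  - near=> i.
    have [dvi + _] : [/\ form_dom b m (v i), form b (v i) (v i) <= q &
      sqnorm (v i) <= N] by near: i.
    move: dvi => /form_domP[se _]; rewrite /form -/(edge_term _ _).
    by split => //; lra.
have [nw _] : rsummable (fun x => w x ^+ 2 * m x) /\
    rsum (fun x => w x ^+ 2 * m x) <= N.
  apply: (@rsum_fatou R _ _ F _ (fun i x => v i x ^+ 2 * m x)).
  - by near=> i => x; exact: sqterm_ge0.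
  - by move=> x; apply: cvgM; [apply: cvgM; exact: vw|exact: cvg_cst].
  - near=> i.
    have [dvi _ ?] : [/\ form_dom b m (v i), form b (v i) (v i) <= q &
      sqnorm (v i) <= N] by near: i.
    by move: dvi => /form_domP[].
by split; [apply/form_domP|rewrite /form -/(edge_term _ _); lra].
Unshelve. all: by end_near. Qed.

End FormDomain.

(** * Sup norm estimates on canonically compactifiable graphs *)

Lemma max_norm_sqr (R : realType) (r s : R) : 0 <= r ->
  Num.max r `|s| ^+ 2 <= r ^+ 2 + s ^+ 2.
Proof.
move=> r0; case: (leP r `|s|) => _.
  by rewrite real_normK ?num_real// lerDr sqr_ge0.
by rewrite lerDl sqr_ge0.
Qed.

(** The maximum of two numbers moves by at most as much as one of them. *)
Lemma max_norm_dist_sqr (R : realType) (r s r' s' : R) :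
  (Num.max r `|s| - Num.max r' `|s'|) ^+ 2 <= (r - r') ^+ 2 + (s - s') ^+ 2.
Proof.
have sq (x y : R) : `|x| <= `|y| -> x ^+ 2 <= y ^+ 2.
  move=> xy; rewrite -[leLHS]real_normK ?num_real//.
  by rewrite -[leRHS]real_normK ?num_real// lerXn2r// nnegrE.
suff : `|Num.max r `|s| - Num.max r' `|s'| | <= `|r - r'| \/
       `|Num.max r `|s| - Num.max r' `|s'| | <= `|s - s'|.
  by case=> /sq; have := sqr_ge0 (r - r'); have := sqr_ge0 (s - s'); lra.
have := ler_dist_dist s s'; have := ler_norm (`|s| - `|s'|).
have := ler_norm (`|s'| - `|s|); rewrite (distrC `|s'|).
have := ler_norm (r - r'); have := ler_norm (r' - r); rewrite (distrC r' r).
move: `|s| `|s'| `|s - s'| `|r - r'| => t t' d e.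
move: `|t - t'| => f He1 He2 Hf1 Hf2 Hfd.
have le_norm (y z : R) : y <= z -> - y <= z -> `|y| <= z.
  by move=> yz Nyz; rewrite ler_norml; apply/andP; split; lra.
case: (leP r t) => rt; case: (leP r' t') => rt'.
- by right; apply: le_norm; lra.
- by have [?|?] := leP t r'; [left|right]; apply: le_norm; lra.
- by have [?|?] := leP r t'; [right|left]; apply: le_norm; lra.
- by left; apply: le_norm; lra.
Qed.

Section Embedding.
Variables (R : realType) (X : countType) (b : X -> X -> R) (m : X -> R).
Implicit Types (u v : X -> R) (w : nat -> X -> R) (a t : R).
Hypothesis bG : is_graph b.
Hypothesis m_gt0 : forall x, 0 < m x.
Hypothesis m_fin : (total_mass m < +oo)%E.
Hypothesis b_cc : canonically_compactifiable b m.

Let domP u : form_dom b m u <->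
  rsummable (edge_term b u u) /\ rsummable (fun x => u x ^+ 2 * m x).
Proof. exact: form_domP. Qed.

Definition form_norm2 u : R := form b u u + sqnorm m u.

Lemma form_norm2_ge0 u : 0 <= form_norm2 u.
Proof. by rewrite addr_ge0 ?form_ge0 ?sqnorm_ge0. Qed.

Lemma rsummable_mass : rsummable m.
Proof. by apply/rsummable_esum => // x; exact: ltW. Qed.

Lemma form_dom_bounded v : form_dom b m v ->
  exists2 B : R, 0 <= B & forall x, `|v x| <= B.
Proof.
move=> dv; case: b_cc => _ /(_ v dv) [M [Mreal HM]].
exists (`|M| + 1); first by rewrite addr_ge0.
by move=> x; apply: HM => //; rewrite ltr_pwDr// ler_norm.
Qed.

(** Taking maxima is subadditive for the squared form norm; sums would cost a
factor. *)
Lemma form_dom_max u v : form_dom b m u -> form_dom b m v ->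
  (forall x, 0 <= u x) ->
  form_dom b m (fun x => Num.max (u x) `|v x|) /\
  form_norm2 (fun x => Num.max (u x) `|v x|) <= form_norm2 u + form_norm2 v.
Proof.
move=> /domP[su nu] /domP[sv nv] u0.
set z := fun x => _.
have lee p : edge_term b z z p <= edge_term b u u p + edge_term b v v p.
  rewrite /edge_term -!mulrA -mulrDr ler_wpM2l//; first by case: bG.
  by rewrite -!expr2 max_norm_dist_sqr.
have len x : z x ^+ 2 * m x <= u x ^+ 2 * m x + v x ^+ 2 * m x.
  by rewrite -mulrDl ler_wpM2r ?(ltW (m_gt0 _))//; exact: max_norm_sqr.
have sz : rsummable (edge_term b z z).
  apply: le_rsummable (rsummableD su sv) => p.
  by rewrite ger0_norm ?edge_term_ge0//; exact: lee.
have nz : rsummable (fun x => z x ^+ 2 * m x).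
  apply: le_rsummable (rsummableD nu nv) => x.
  by rewrite ger0_norm ?sqterm_ge0//; exact: len.
split; first by apply/domP.
rewrite /form_norm2 addrACA lerD//; last first.
  by rewrite /sqnorm -rsumD// ler_rsum// rsummableD.
rewrite /form -/(edge_term b u u) -/(edge_term b v v) -/(edge_term b z z).
rewrite -mulrDr ler_wpM2l ?invr_ge0// -rsumD// ler_rsum//; exact: rsummableD.
Qed.

Fixpoint running_max w n x : R :=
  if n is n'.+1 then Num.max (running_max w n' x) `|w n' x| else 0.

Lemma running_max_ge0 w n x : 0 <= running_max w n x.
Proof. by elim: n => //= n IH; rewrite le_max IH. Qed.

Lemma running_max_le w n x : running_max w n x <= running_max w n.+1 x.
Proof. by rewrite /= le_max lexx. Qed.

Lemma running_max_dom (w : nat -> X -> R) :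
  (forall n, form_dom b m (w n) /\ form_norm2 (w n) <= 2^-1 ^+ n) ->
  forall n, form_dom b m (running_max w n) /\
            form_norm2 (running_max w n) <= 2 - 2 * 2^-1 ^+ n.
Proof.
move=> wE; elim=> [|n [dn En]] /=.
  split; first exact: form_dom0.
  rewrite /form_norm2 form_cst /sqnorm [X in rsum X](_ : _ = fun=> 0).
    by rewrite rsum0; lra.
  by apply/funext => x; rewrite expr0n mul0r.
have [dw Ew] := wE n.
have [dm Em] := form_dom_max dn dw (running_max_ge0 w n).
by split => //; apply: le_trans Em _; rewrite exprS; lra.
Qed.

(** The running maxima of the [|w n|] have bounded form norm and increase to a
function of the form domain, which is bounded by hypothesis and dominates every
[|w n|]. *)
Lemma no_gliding_hump w (p : nat -> X) :
  (forall n, form_dom b m (w n) /\ form_norm2 (w n) <= 2^-1 ^+ n) ->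
  exists n, w n (p n) ^+ 2 <= n.+1%:R.
Proof.
move=> wE; have WE := running_max_dom wE; set W := running_max w in WE.
have EW2 n : form b (W n) (W n) <= 2 /\ sqnorm m (W n) <= 2.
  have [_] := WE n; rewrite /form_norm2.
  have := form_ge0 bG (W n); have := sqnorm_ge0 m_gt0 (W n).
  have : 0 <= (2^-1 : R) ^+ n by rewrite exprn_ge0.
  by split; lra.
have Wbnd n x : W n x <= 1 + 2 / m x.
  have [dW _] := WE n; have := sqterm_le_sqnorm bG m_gt0 x dW.
  have [_ N2] := EW2 n; move=> /le_trans/(_ N2); rewrite -ler_pdivlMr//.
  have := running_max_ge0 w n x; rewrite -/(W n x).
  by have := sqr_ge0 (W n x - 1); nra.
have Wnd x : nondecreasing_seq (W ^~ x).
  by apply/nondecreasing_seqP => n; exact: running_max_le.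
pose s x := limn (W ^~ x).
have Wc x : cvgn (W ^~ x).
  apply: nondecreasing_is_cvgn => //.
  by exists (1 + 2 / m x) => _ [n _ <-].
have Wle n x : W n x <= s x by exact: nondecreasing_cvgn_le.
have [ds _] : form_dom b m s /\ form b s s <= 2.
  apply: (form_dom_limit (v := W) (F := \oo) (N := 2) bG m_gt0 _ _ Wc).
  by near=> n; have [dW _] := WE n; have [? ?] := EW2 n.
have [B B0 sB] := form_dom_bounded ds.
exists (Num.truncn (B ^+ 2)); set n := Num.truncn _.
have wB : `|w n (p n)| <= B.
  apply: le_trans (sB (p n)); apply: le_trans (ler_norm _).
  apply: le_trans (Wle n.+1 _).
  by rewrite /W /= le_max lexx orbT.
apply: (@le_trans _ _ (B ^+ 2)); last by rewrite ltW// truncnS_gt.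
by rewrite -real_normK ?num_real// lerXn2r// nnegrE.
Unshelve. all: by end_near. Qed.

(** If no constant works, the constants [(n + 1) * 2 ^ n] fail for suitable
functions; scaled to squared form norm [2 ^- n], these functions contradict
[no_gliding_hump]. *)
Lemma sup_embedding : exists2 K : R, 0 < K &
  forall v, form_dom b m v -> forall x, v x ^+ 2 <= K * form_norm2 v.
Proof.
apply: contrapT => noK.
have bad (n : nat) : exists wp : (X -> R) * X,
    [/\ form_dom b m wp.1, form_norm2 wp.1 <= 2^-1 ^+ n &
        n.+1%:R < wp.1 wp.2 ^+ 2].
  have Kn0 : 0 < n.+1%:R * (2 : R) ^+ n by rewrite mulr_gt0// exprn_gt0.
  have [v [dv [x vx]]] : exists v, form_dom b m v /\
      exists x, n.+1%:R * 2 ^+ n * form_norm2 v < v x ^+ 2.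
    apply: contrapT => H; apply: noK; exists (n.+1%:R * 2 ^+ n) => // v dv x.
    rewrite leNgt; apply/negP => ?; apply: H.
    by exists v; split => //; exists x.
  have E0 : 0 < form_norm2 v.
    have vx0 : 0 < v x ^+ 2.
      by apply: le_lt_trans vx; rewrite mulr_ge0 ?form_norm2_ge0// ltW.
    apply: (@lt_le_trans _ _ (v x ^+ 2 * m x)); first by rewrite mulr_gt0.
    apply: le_trans (sqterm_le_sqnorm bG m_gt0 x dv) _.
    by rewrite lerDr form_ge0.
  pose a := Num.sqrt (2^-1 ^+ n / form_norm2 v).
  have a2 : a ^+ 2 = 2^-1 ^+ n / form_norm2 v.
    by rewrite sqr_sqrtr// divr_ge0 ?ltW// exprn_gt0.
  exists (fun y => a * v y, x); split => /=.
  - exact: form_domZ.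
  - rewrite /form_norm2 (form_scale bG m_gt0 _ dv) (sqnorm_scale bG m_gt0 _ dv).
    by rewrite -mulrDr a2 -/(form_norm2 v) divfK// gt_eqF.
  - rewrite exprMn a2 mulrAC ltr_pdivlMr//.
    apply: le_lt_trans (_ : 2^-1 ^+ n * (n.+1%:R * 2 ^+ n * form_norm2 v) < _).
      rewrite !mulrA [2^-1 ^+ _ * _]mulrC -[_ * _ * 2 ^+ _]mulrA -exprMn.
      by rewrite mulVf ?pnatr_eq0// expr1n mulr1.
    by rewrite ltr_pM2l// exprn_gt0.
have [wp wpE] := choice bad.
have [n] := @no_gliding_hump (fun n => (wp n).1) (fun n => (wp n).2)
  (fun n => let: And3 d e _ := wpE n in conj d e).
by have [_ _] := wpE n; rewrite ltNge => /negP.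
Qed.

Lemma path_bound x s : path (fun y z => 0 < b y z) x s ->
  exists2 C : R, 0 <= C & forall v, form_dom b m v ->
    (v x - v (last x s)) ^+ 2 <= C * form b v v.
Proof.
elim: s x => [|y s IH] x /=.
  by move=> _; exists 0 => // v _; rewrite subrr expr0n mul0r.
move=> /andP[bxy /IH[C C0 HC]].
exists (2 * (2 / b x y) + 2 * C).
  by rewrite addr_ge0 ?mulr_ge0 ?invr_ge0 ?(ltW bxy).
move=> v dv; have := HC v dv.
have : (v x - v y) ^+ 2 <= 2 / b x y * form b v v.
  rewrite mulrAC ler_pdivlMr// mulrC; exact: (edge_le_form bG m_gt0).
have := sqr_ge0 ((v x - v y) - (v y - v (last y s))).
set q := form b v v; move: (v x) (v y) (v (last y s)) => r1 r2 r3.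
by move: (2 / b x y) => e; nra.
Qed.

(** With [q] the energy and [N] the squared l2 norm of [v], the vertices of [A]
contribute to [N] at most a multiple of [q], by paths to [o], and the other
vertices at most [(q + N) / 2], by [sup_embedding] and the choice of [A]; hence
[N] is bounded by a multiple of [q]. *)
Lemma poincare (o : X) : exists2 K : R, 0 < K &
  forall v, form_dom b m v -> v o = 0 -> forall x, v x ^+ 2 <= K * form b v v.
Proof.
have [K0 K0gt HK0] := sup_embedding.
have [conn _] := b_cc.
have /choice[C HC] : forall x, exists C : R, 0 <= C /\
    forall v, form_dom b m v -> (v x - v o) ^+ 2 <= C * form b v v.
  move=> x; have [->|/conn[s]] := eqVneq x o.
    by exists 0; split => // v _; rewrite subrr expr0n mul0r.
  by move=> /path_bound[C C0 HC]; exists C; rewrite last_rcons in HC.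
have K2 : 0 < (2 * K0)^-1 by rewrite invr_gt0 mulr_gt0.
have [A tA] := rsum_tail (fun x => ltW (m_gt0 x)) rsummable_mass K2.
have sS := rsummable_restr (fun x => C x * m x) A.
pose S := rsum (fun x => C x * m x * (x \in A)%:R).
have S0 : 0 <= S.
  by apply: rsum_ge0 => x; rewrite !mulr_ge0//; [case: (HC x)|exact: ltW].
exists (K0 * (2 * S + 2)); first by rewrite mulr_gt0// ltr_wpDl// mulr_ge0.
move=> v dv vo x.
have q0 := form_ge0 bG v; have E0 := form_norm2_ge0 v.
have st : rsummable (fun x => m x * (x \notin A)%:R).
  apply: le_rsummable rsummable_mass => y.
  rewrite ger0_norm; last by rewrite mulr_ge0 ?(ltW (m_gt0 _)).
  by rewrite ler_piMr ?(ltW (m_gt0 _))// lern1 leq_b1.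
have : sqnorm m v <= form b v v * S +
    K0 * form_norm2 v * rsum (fun x => m x * (x \notin A)%:R).
  have s1 := rsummableZ (form b v v) sS.
  have s2 := rsummableZ (K0 * form_norm2 v) st.
  rewrite /S -(rsumZ _ sS) -(rsumZ _ st) -(rsumD s1 s2).
  have [_ nv] := (domP v).1 dv.
  apply: ler_rsum => // [|y]; first exact: rsummableD.
  case: (boolP (y \in A)) => yA /=.
    rewrite !mulr0 addr0 mulr1 mulrA (mulrC (form b v v)).
    rewrite ler_wpM2r ?(ltW (m_gt0 _))//.
    by have [_ /(_ v dv)] := HC y; rewrite vo subr0.
  by rewrite !mulr0 add0r mulr1 ler_wpM2r ?(ltW (m_gt0 _))//; exact: HK0.
have tE : K0 * form_norm2 v * rsum (fun x => m x * (x \notin A)%:R)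
    <= form_norm2 v / 2.
  apply: le_trans (_ : K0 * form_norm2 v * (2 * K0)^-1 <= _).
    by rewrite ler_wpM2l// mulr_ge0// ltW.
  by rewrite [leLHS](_ : _ = form_norm2 v / 2)//; field; rewrite gt_eqF.
move=> /le_trans-/(_ _ (lerD (lexx _) tE)).
have := HK0 v dv x; rewrite /form_norm2 -/S => vx nE.
apply: le_trans vx _; rewrite -mulrA ler_pM2l//; lra.
Qed.

End Embedding.

(** * Elementary inequalities for the first variation *)

Lemma expR_second_order (R : realType) (z : R) : `|z| <= 1 / 2 ->
  `|expR z - 1 - z| <= 2 * z ^+ 2.
Proof.
rewrite ler_norml => /andP[z1 z2].
have lo := expR_ge1Dx z; have := expR_ge1Dx (- z).
rewrite expRN => le1.
have e0 := expR_gt0 z.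
have hi : (1 - z) * expR z <= 1 by rewrite -ler_pdivlMr// div1r.
rewrite ler_norml; apply/andP; split; first by have := sqr_ge0 z; lra.
by nra.
Qed.

(** Test with [s = - t * E] for small [t > 0]. *)
Lemma first_order_zero (R : realType) (E C s0 : R) : 0 < s0 ->
  (forall s, `|s| <= s0 -> 0 <= s * E + C * s ^+ 2) -> E = 0.
Proof.
move=> s00 H; apply/eqP; apply/negPn/negP => E0.
have nE : 0 < `|E| by rewrite normr_gt0.
have C0 : 0 < 2 * (`|C| + 1) by rewrite mulr_gt0// ltr_wpDl.
pose t := Num.min (s0 / `|E|) (1 / (2 * (`|C| + 1))).
have t0 : 0 < t by rewrite lt_min !divr_gt0.
have tE : `| - t * E | <= s0.
  rewrite normrM normrN (gtr0_norm t0) -ler_pdivlMr//.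
  by rewrite ge_min lexx.
have tC : t * (2 * (`|C| + 1)) <= 1.
  by rewrite -ler_pdivlMr// ge_min lexx orbT.
have := H _ tE.
have CC : C * t <= 1 / 2.
  have := ler_norm C; nra.
have E2 : 0 < t * E ^+ 2 by rewrite mulr_gt0// exprn_even_gt0.
have -> : - t * E * E + C * (- t * E) ^+ 2 = (t * E ^+ 2) * (C * t - 1) by ring.
by rewrite pmulr_rge0//; lra.
Qed.

(** The remainder of the first variation is quadratic in [s].  In the
application, [H] and [H + s * A + r] are the exponential masses before and after
the variation, [P] is the first-order coefficient of the terms of the functional
other than the logarithm, whose coefficient is [- k], and [q] is the energy of
the direction. *)
Lemma variation_bound (R : realType) (s P H A r q k D : R) :
  0 <= q -> 0 <= k -> 0 <= D -> `|s| <= 1 -> `|r| <= D * s ^+ 2 ->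
  0 <= H + s * A + r ->
  (s * P + s ^+ 2 * q / 2) * (H + s * A + r) + k * (H - (H + s * A + r)) <=
  s * (P * H - k * A)
  + (`|P| * (`|A| + D) + q * (H + `|A| + D) + k * D) * s ^+ 2.
Proof.
move=> q0 k0 D0 s1 rD Hv0.
have s2 : s ^+ 2 <= `|s| by rewrite -real_normK ?num_real// expr2 ler_piMl.
have t1 : s ^+ 2 * (P * A) <= `|P| * `|A| * s ^+ 2.
  by rewrite mulrC ler_wpM2r ?sqr_ge0// -normrM ler_norm.
have t2 : s * P * r <= `|P| * D * s ^+ 2.
  apply: le_trans (ler_norm _) _; rewrite !normrM.
  rewrite (mulrC `|s|) -!mulrA ler_wpM2l//.
  by apply: le_trans rD; rewrite ler_piMl.
have t3 : s ^+ 2 * (q / 2) * (H + s * A + r) <= q * (H + `|A| + D) * s ^+ 2.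
  have sA : s * A <= `|A|.
    by apply: le_trans (ler_norm _) _; rewrite normrM ler_piMl.
  have rD' : r <= D.
    apply: le_trans (ler_norm _) _; apply: le_trans rD _.
    by rewrite ler_piMr// (le_trans s2).
  have le : H + s * A + r <= H + `|A| + D by lra.
  have sq0 := mulr_ge0 (sqr_ge0 s) q0.
  have := ler_wpM2l sq0 le; have := mulr_ge0 sq0 Hv0.
  by lra.
have t4 : - (k * r) <= k * D * s ^+ 2.
  rewrite -mulrN -mulrA ler_wpM2l//.
  by apply: le_trans rD; rewrite -normrN ler_norm.
by lra.
Qed.

(** * The variational problem *)

Lemma ultra_pointwise_limit (R : realType) (I T : Type) (G : set_system I)
    (v : I -> T -> R) (B : R) : UltraFilter G ->
  (forall i t, `|v i t| <= B) ->
  exists w : T -> R, forall t, v i t @[i --> G] --> w t.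
Proof.
move=> GU vB; suff /choice : forall t, exists l : R, v i t @[i --> G] --> l.
  by move=> [w vw]; exists w.
move=> t; have UG : UltraFilter (v ^~ t @ G).
  split; first exact: fmap_proper_filter.
  move=> H HF GH; apply/seteqP; split => // A HA.
  have [//|GnA] := in_ultra_setVsetC ((v ^~ t) @^-1` A) GU.
  exfalso; have HnA : H (~` A) by apply: GH.
  by have [z []] := @filter_ex _ H HF _ (filterI HA HnA).
have := @segment_compact R (- B) B; rewrite compact_ultra.
move=> /(_ _ UG)[|l [_ ?]]; last by exists l.
apply: (filterE (F := G)) => i.
by rewrite /= in_itv /= -ler_norml; exact: vB.
Qed.

Section Functional.
Variables (R : realType) (X : countType) (b : X -> X -> R) (m : X -> R).
Variables (c : R) (h : X -> R).
Implicit Types (u v w : X -> R).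
Hypothesis bG : is_graph b.
Hypothesis m_gt0 : forall x, 0 < m x.
Hypothesis m_fin : (total_mass m < +oo)%E.
Hypothesis b_cc : canonically_compactifiable b m.
Hypothesis c_gt0 : 0 < c.
Hypothesis h2 : ell2 m h.

Local Notation M := (rsum m).
Let sm : rsummable m. Proof. exact: rsummable_mass. Qed.

Lemma ell2_rsummable u : ell2 m u -> rsummable (fun x => u x * m x).
Proof.
move=> /ell2P-/(_ m_gt0) nu.
apply: le_rsummable (rsummableD nu sm) => x.
rewrite normrM (gtr0_norm (m_gt0 x)) -[X in _ + X]mul1r -mulrDl.
rewrite ler_wpM2r ?(ltW (m_gt0 x))//.
have := sqr_ge0 (`|u x| - 1); have := real_normK (num_real (u x)).
by nra.
Qed.

Definition exp_mass v : R := rsum (fun x => h x * expR (v x) * m x).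

Definition mean v : R := rsum (fun x => v x * m x).

Definition energy_functional v : R :=
  2^-1 * form b v v + c * mean v - c * M * ln (exp_mass v).

Lemma exp_term_le v B x : v x <= B ->
  `|h x * expR (v x) * m x| <= expR B * `|h x * m x|.
Proof.
move=> vB; rewrite mulrAC normrM (ger0_norm (expR_ge0 _)) mulrC.
by rewrite ler_wpM2r// ler_expR.
Qed.

Lemma rsummable_exp v : form_dom b m v ->
  rsummable (fun x => h x * expR (v x) * m x).
Proof.
move=> /(form_dom_bounded b_cc)[B _ vB].
apply: le_rsummable (rsummableZ (expR B) (rsummable_norm (ell2_rsummable h2))).
by move=> x; apply: exp_term_le; apply: le_trans (ler_norm _) (vB x).
Qed.

Lemma form_dom_cst t : form_dom b m (fun=> t).
Proof.
apply/form_domP => //; split.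
  apply: le_rsummable (rsummable_restr (fun=> 0) fset0) => p.
  by rewrite /edge_term subrr !mulr0 normr0 /= ?mul0r.
exact: rsummableZ.
Qed.

Lemma form_dom_shift t v : form_dom b m v -> form_dom b m (fun x => v x + t).
Proof.
move=> dv; have := form_domD bG m_gt0 1 dv (form_dom_cst t).
by under [X in form_dom b m X]eq_fun do rewrite mul1r.
Qed.

Lemma rsummable_mean v : form_dom b m v -> rsummable (fun x => v x * m x).
Proof. by case=> _; exact: ell2_rsummable. Qed.

Lemma mean_ge v B : (forall x, `|v x| <= B) -> - (B * M) <= mean v.
Proof.
move=> vB; have : `|mean v| <= rsum (fun x => B * m x).
  apply: ler_norm_rsum => [|x]; first exact: rsummableZ.
  by rewrite normrM (gtr0_norm (m_gt0 x)) ler_wpM2r// ltW.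
by rewrite (rsumZ _ sm) ler_norml => /andP[].
Qed.

Lemma sqnorm_le v B : form_dom b m v -> (forall x, `|v x| <= B) ->
  sqnorm m v <= B ^+ 2 * M.
Proof.
move=> /(form_domP bG m_gt0)[_ nv] vB; rewrite -(rsumZ _ sm).
apply: ler_rsum => //; first exact: rsummableZ.
move=> x; rewrite ler_wpM2r ?(ltW (m_gt0 x))// -real_normK ?num_real//.
by rewrite lerXn2r ?nnegrE// (le_trans (normr_ge0 _) (vB x)).
Qed.

Lemma exp_mass_shift t v : form_dom b m v ->
  exp_mass (fun x => v x + t) = expR t * exp_mass v.
Proof.
move=> dv; rewrite /exp_mass -(rsumZ _ (rsummable_exp dv)).
by congr rsum; apply/funext => x; rewrite expRD; ring.
Qed.

Lemma mean_shift t v : form_dom b m v ->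
  mean (fun x => v x + t) = mean v + t * M.
Proof.
move=> dv; rewrite /mean -(rsumZ _ sm).
rewrite -(rsumD (rsummable_mean dv) (rsummableZ t sm)).
by congr rsum; apply/funext => x; ring.
Qed.

Lemma form_shift t v :
  form b (fun x => v x + t) (fun x => v x + t) = form b v v.
Proof.
rewrite form_cst_l /form; congr (_ * rsum _); apply/funext => p.
by congr (_ * _ * _); ring.
Qed.

Lemma energy_functional_shift t v : form_dom b m v -> 0 < exp_mass v ->
  energy_functional (fun x => v x + t) = energy_functional v.
Proof.
move=> dv Hv. rewrite /energy_functional.
rewrite form_shift.
rewrite (mean_shift t dv).
rewrite (exp_mass_shift t dv).
rewrite lnM ?posrE ?expR_gt0//. rewrite expRK.
by move: (form _ _ _) (mean v) (ln _) (rsum m) => ? ? ? ?; ring.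
Qed.

Variable o : X.
Hypothesis ho : 0 < h o.

Let M_gt0 : 0 < M.
Proof.
apply: lt_le_trans (m_gt0 o) _.
by apply: (term_le_rsum o) => // x; exact: ltW.
Qed.

Local Notation S := (rsum (fun x => `|h x * m x|)).
Let sS : rsummable (fun x => `|h x * m x|).
Proof. exact/rsummable_norm/ell2_rsummable. Qed.

Let S_gt0 : 0 < S.
Proof.
apply: lt_le_trans (term_le_rsum o _ sS) => [|x] //.
by rewrite normr_gt0 gt_eqF// mulr_gt0.
Qed.

(** The functional is invariant under the addition of constants, so it can be
coercive only after a normalization such as the one at [o]. *)
Definition admissible v := [/\ form_dom b m v, v o = 0 & 0 < exp_mass v].

(** A function that is 0 at [o] and very negative elsewhere concentrates the
exponential mass at [o], where [h] is positive. *)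
Lemma admissible_exists : exists v, admissible v.
Proof.
have k0 : 0 < h o * m o by exact: mulr_gt0.
set k := h o * m o in k0.
(* [v] is [ln e] off [o]; the mass there is at most [e * S], hence below [k] *)
pose e := k / (S + S + k).
have d0 : 0 < S + S + k by exact: addr_gt0 (addr_gt0 S_gt0 S_gt0) k0.
have e0 : 0 < e by exact: divr_gt0.
have eS : e * S <= k / 2.
  have : e * (S + S + k) = k by rewrite divfK// gt_eqF.
  have := mulr_gt0 e0 k0; lra.
pose v x := ln e + - ln e * (x == o)%:R.
have dv : form_dom b m v.
  apply: form_domD => //; [exact: form_dom_cst|exact: form_dom_indic].
exists v; split => //; first by rewrite /v eqxx mulr1 subrr.
pose f x := `|h x * m x| * (x \in [fset o]%fset)%:R.
have sf : rsummable f by exact: rsummable_restr.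
have kf : k <= rsum f.
  have := rsum_restr [fset o]%fset (fun x => normr_ge0 (h x * m x)).
  by rewrite big_seq_fset1 gtr0_norm.
apply: (@lt_le_trans _ _ (rsum f - e * S)); first by move: kf eS k0; lra.
rewrite -(rsumZ _ sS) -(rsumB sf (rsummableZ e sS)).
apply: ler_rsum; [exact/rsummableB/rsummableZ|exact: rsummable_exp|].
move=> x; rewrite /f /v !inE; case: eqVneq => [->|xo] /=.
  rewrite !mulr1 subrr expR0 mulr1 ler_wnDr ?ler_norm//.
    by rewrite -/k (gtr0_norm k0) oppr_le0 mulr_ge0// ltW.
  by rewrite -/k (gtr0_norm k0).
rewrite !mulr0 addr0 sub0r lnK ?posrE//.
rewrite [leRHS](_ : _ = e * (h x * m x)); last by ring.
rewrite -mulrN ler_wpM2l ?(ltW e0)//.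
by have := ler_norm (- (h x * m x)); rewrite normrN; lra.
Qed.

(** By [poincare] the sup norm grows at most like the square root of the energy
[q]; the mean and the logarithm grow at most like the sup norm, so [q / 2]
dominates them. *)
Lemma coercive : exists K1 K2 K3 : R, [/\ 0 <= K1, 0 <= K2 &
  forall v, admissible v ->
    (forall x, `|v x| <= K1 * form b v v + K2) /\
    form b v v / 4 - K3 <= energy_functional v].
Proof.
have [K K0 HK] := poincare bG m_gt0 m_fin b_cc o.
have cM : 0 < c * M by rewrite mulr_gt0.
have [a [a0 aE]] : exists a, 0 < a /\ a = 2 * (c * M).
  by exists (2 * (c * M)); split => //; rewrite mulr_gt0.
exists (4 * a)^-1, (a * K), (a ^+ 2 * K + c * M * ln S); split.
- by rewrite invr_ge0 mulr_ge0// ltW.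
- by rewrite mulr_ge0// ltW.
move=> v [dv vo Hv].
have q0 := form_ge0 bG v; set q := form b v v in q0 *.
(* [B ^ 2 >= K * q] is an instance of the inequality of the arithmetic and
   geometric means, weighted so that [a * B] costs only a quarter of [q] *)
pose B := (4 * a)^-1 * q + a * K.
have B0 : 0 <= B.
  apply: addr_ge0; apply: mulr_ge0 => //; last 2 first; try exact: ltW.
  by rewrite invr_ge0 mulr_ge0 ?(ltW a0).
have aB : a * B = q / 4 + a ^+ 2 * K.
  by rewrite /B; field; rewrite gt_eqF.
have vB x : `|v x| <= B.
  rewrite -[leRHS](ger0_norm B0) -(@ler_pXn2r _ 2)// ?nnegrE//.
  rewrite !real_normK ?num_real//; apply: le_trans (HK v dv vo x) _.
  rewrite -(@ler_pM2l _ (a ^+ 2)) ?exprn_gt0// -exprMn aB.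
  rewrite -/q; have := sqr_ge0 (q / 4 - a ^+ 2 * K); lra.
split => //.
have meanB := mean_ge vB.
have lnB : ln (exp_mass v) <= B + ln S.
  rewrite -[B](expRK) -lnM ?posrE ?expR_gt0// ler_ln ?posrE//; last first.
    by rewrite mulr_gt0// expR_gt0.
  apply: le_trans (ler_norm _) _.
  have := ler_norm_rsum (rsummableZ (expR B) sS) (fun x =>
    exp_term_le (le_trans (ler_norm _) (vB x))).
  by rewrite (rsumZ _ sS).
have lnB' : c * M * ln (exp_mass v) <= c * M * (B + ln S).
  by rewrite ler_wpM2l// ltW.
have meanB' : c * - (B * M) <= c * mean v by rewrite ler_wpM2l// ltW.
rewrite /energy_functional -/q.
have : 2 * (c * M) * B = q / 4 + a ^+ 2 * K by rewrite -aE.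
by move: lnB' meanB'; lra.
Qed.

Lemma exp_mass_cvg (I : Type) (F : set_system I) (v : I -> X -> R) w (B : R) :
  ProperFilter F ->
  (\forall i \near F, forall x, `|v i x| <= B) ->
  (forall x, v i x @[i --> F] --> w x) ->
  exp_mass (v i) @[i --> F] --> exp_mass w.
Proof.
move=> FF vB vw; apply: (rsum_dominated (rsummableZ (expR B) sS)).
  apply: filterS vB => i vB x; apply: exp_term_le.
  exact: le_trans (ler_norm _) (vB x).
move=> x; apply: cvgM; last exact: cvg_cst.
apply: cvgM; first exact: cvg_cst.
by apply: continuous_cvg; [exact: continuous_expR|exact: vw].
Qed.

Lemma mean_cvg (I : Type) (F : set_system I) (v : I -> X -> R) w (B : R) :
  ProperFilter F ->
  (\forall i \near F, forall x, `|v i x| <= B) ->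
  (forall x, v i x @[i --> F] --> w x) ->
  mean (v i) @[i --> F] --> mean w.
Proof.
move=> FF vB vw; apply: (rsum_dominated (rsummableZ B sm)).
  apply: filterS vB => i vB x.
  by rewrite normrM (gtr0_norm (m_gt0 x)) ler_wpM2r// ltW.
by move=> x; apply: cvgM; [exact: vw|exact: cvg_cst].
Qed.

(** The direct method: along an ultrafilter the mean and the exponential mass of
the minimizing sequence converge, and the energy is lower semicontinuous.  The
limit keeps a positive exponential mass because the logarithm in the functional
keeps the masses of the sequence away from zero. *)
Lemma minimizer_exists : exists2 w, admissible w &
  forall v, admissible v -> energy_functional w <= energy_functional v.
Proof.
have [K1 [K2 [K3 [K10 K20 HK]]]] := coercive.
have cM : 0 < c * M by exact: mulr_gt0.
pose E := [set energy_functional v | v in admissible].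
have infE : has_inf E.
  split.
    by have [v dv] := admissible_exists; exists (energy_functional v), v.
  exists (- K3) => _ [v dv <-]; have [_] := HK v dv; case: dv => dv _ _.
  have := form_ge0 bG v.
  move: (form _ _ _) (energy_functional v) => q e q0.
  by move=> /(le_trans _); apply; lra.
have lbE v : admissible v -> inf E <= energy_functional v.
  by move=> av; apply: (ge_inf infE.2); exists v.
have /choice[v vE] : forall n : nat, exists v, admissible v /\
    energy_functional v < inf E + n.+1%:R^-1.
  move=> n; have n0 : 0 < n.+1%:R^-1 :> R by rewrite invr_gt0.
  by have [_ [v av <-] lt] := inf_adherent n0 infE; exists v.
pose q := 4 * (inf E + 1 + K3).
have vq n : form b (v n) (v n) <= q.
  have [av lt] := vE n; have [_] := HK _ av.
  have : n.+1%:R^-1 <= 1 :> R by rewrite invf_le1// ler1n.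
  rewrite /q; move: lt.
  move: (form _ _ _) (energy_functional _) (inf E) n.+1%:R^-1.
  by move=> ? ? ? ?; lra.
pose B := K1 * q + K2.
have vB n x : `|v n x| <= B.
  have [/HK[+ _] _] := vE n; move=> /(_ x)/le_trans; apply.
  by rewrite /B lerD2r ler_wpM2l.
have [G [GU sG]] := @ultraFilterLemma nat \oo _.
have [w vw] := ultra_pointwise_limit GU vB.
have nearB : \forall n \near G, forall x, `|v n x| <= B by exact: filterE.
have PG : ProperFilter G by exact: ultra_proper.
have Hw := exp_mass_cvg PG nearB vw.
have mw := mean_cvg PG nearB vw.
have [d d0 dH] : exists2 d, 0 < d & forall n, d <= exp_mass (v n).
  pose d := - (B * M) * c - (inf E + 1).
  exists (expR (d / (c * M))); first exact: expR_gt0.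
  move=> n; have [[dv _ Hv] lt] := vE n.
  rewrite -[leRHS]lnK ?posrE// ler_expR ler_pdivrMr// mulrC.
  have : n.+1%:R^-1 <= 1 :> R by rewrite invf_le1// ler1n.
  have := mean_ge (vB n); move/(ler_wpM2l (ltW c_gt0)).
  move: lt; rewrite /energy_functional /d; have := form_ge0 bG (v n).
  move: (form _ _ _) (mean _) (ln _) (rsum m) (inf E) n.+1%:R^-1.
  by move=> ? ? ? ? ? ?; lra.
have Hw0 : 0 < exp_mass w.
  by apply: lt_le_trans d0 _; apply: (cvgr_to_ge Hw); exact: filterE.
have Lw : ln (exp_mass (v n)) @[n --> G] --> ln (exp_mass w).
  by apply: continuous_cvg => //; exact: continuous_ln.
have wo : w o = 0.
  have vo : v n o @[n --> G] --> (0 : R).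
    have -> : (fun n => v n o) = fun=> 0.
      by apply/funext => n; have [[]] := vE n.
    exact: cvg_cst.
  exact: (cvg_unique _ (vw o) vo).
(* twice [r n] bounds the energy of [v n], and [r] involves only quantities that
   converge *)
pose r n := inf E + n.+1%:R^-1 - c * mean (v n) + c * M * ln (exp_mass (v n)).
have rw : r n @[n --> G] --> inf E + 0 - c * mean w + c * M * ln (exp_mass w).
  apply: cvgD; last by apply: cvgM => //; exact: cvg_cst.
  apply: cvgB; last by apply: cvgM => //; exact: cvg_cst.
  apply: cvgD; first exact: cvg_cst.
  by apply: cvg_trans (@cvg_harmonic R); apply: cvg_app.
have vr n : form b (v n) (v n) <= 2 * r n.
  have [_] := vE n; rewrite /energy_functional /r.
  move: (form _ _ _) (mean _) (ln _) (rsum m) (inf E) n.+1%:R^-1.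
  by move=> ? ? ? ? ? ?; lra.
have qw (e : R) : 0 < e -> form_dom b m w /\
    form b w w <= 2 * (inf E - c * mean w + c * M * ln (exp_mass w) + e).
  move=> e0; apply: (form_dom_limit (N := B ^+ 2 * M) bG m_gt0 PG _ vw).
  have re : inf E + 0 - c * mean w + c * M * ln (exp_mass w) <
      inf E - c * mean w + c * M * ln (exp_mass w) + e by rewrite addr0 ltrDl.
  have nr := @cvgr_le _ _ G _ _ _ rw _ re.
  have FG : Filter G by exact: (@filter_filter _ _ PG).
  apply: filterS (nr FG) => n rn; have [[dv _ _] _] := vE n.
  split => //; last exact: sqnorm_le dv (vB n).
  by apply: le_trans (vr n) _; rewrite (ler_pM2l _).
have dw : form_dom b m w by have [] := qw 1 ltr01.
exists w; first by split.
move=> u au; apply: le_trans (lbE u au).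
apply/ler_addgt0Pr => e e0; have [_] := qw e e0.
rewrite /energy_functional.
by move: (form _ _ _) (mean _) (ln _) (rsum m) (inf E) => ? ? ? ? ?; lra.
Qed.

Lemma minimizer_global w :
  (forall v, admissible v -> energy_functional w <= energy_functional v) ->
  forall v, form_dom b m v -> 0 < exp_mass v ->
    energy_functional w <= energy_functional v.
Proof.
move=> wmin v dv Hv.
rewrite -(energy_functional_shift (- v o) dv Hv); apply: wmin; split.
- exact: form_dom_shift.
- by rewrite subrr.
- by rewrite exp_mass_shift// mulr_gt0// expR_gt0.
Qed.

Lemma exp_mass_expand w p : form_dom b m w -> form_dom b m p ->
  exists D s0 : R, [/\ 0 <= D, 0 < s0 & forall s, `|s| <= s0 ->
    `|exp_mass (fun x => w x + s * p x) - exp_mass w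
      - s * rsum (fun x => h x * expR (w x) * p x * m x)| <= D * s ^+ 2].
Proof.
move=> dw dp; have [B B0 pB] := form_dom_bounded b_cc dp.
have sw := rsummable_exp dw.
have swp : rsummable (fun x => h x * expR (w x) * p x * m x).
  apply: le_rsummable (rsummableZ B (rsummable_norm sw)) => x.
  by rewrite mulrAC normrM mulrC ler_wpM2r.
pose N := rsum (fun x => `|h x * expR (w x) * m x|).
have N0 : 0 <= N by exact: rsum_ge0.
have B1 : 0 < 2 * (B + 1) by rewrite mulr_gt0// ltr_wpDl.
exists (2 * B ^+ 2 * N), (1 / (2 * (B + 1))); split.
- by rewrite !mulr_ge0// sqr_ge0.
- by rewrite divr_gt0.
move=> s; rewrite ler_pdivlMr// => sB.
have sps : rsummable (fun x => h x * expR (w x + s * p x) * m x).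
  exact: rsummable_exp (form_domD bG m_gt0 s dw dp).
rewrite /exp_mass -(rsumB sps sw) -(rsumZ _ swp).
rewrite -(rsumB (rsummableB sps sw) (rsummableZ s swp)).
rewrite [leRHS](_ : _ = (2 * B ^+ 2 * s ^+ 2) * N); last by ring.
rewrite /N -(rsumZ _ (rsummable_norm sw)).
apply: ler_norm_rsum => [|x]; first exact/rsummableZ/rsummable_norm.
rewrite expRD [X in `|X|](_ : _ = (expR (s * p x) - 1 - s * p x) *
  (h x * expR (w x) * m x)); last by ring.
rewrite normrM ler_wpM2r//.
have sp : `|s * p x| <= 1 / 2.
  rewrite normrM; have := ler_wpM2l (normr_ge0 s) (pB x).
  by have := normr_ge0 s; lra.
apply: le_trans (expR_second_order sp) _.
rewrite -mulrA ler_pM2l// exprMn mulrC ler_wpM2r ?sqr_ge0//.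
by rewrite -real_normK ?num_real// lerXn2r ?nnegrE.
Qed.

(** The variation [w + s * p] does not decrease the functional.  With the bound
[ln H - ln Hv <= H / Hv - 1] and the factor [Hv] cleared, this reads
[0 <= s * E + O(s ^ 2)] for small [s] of either sign, so that [E = 0]. *)
Lemma euler_lagrange w : form_dom b m w -> 0 < exp_mass w ->
  (forall v, form_dom b m v -> 0 < exp_mass v ->
    energy_functional w <= energy_functional v) ->
  forall p, form_dom b m p ->
  (form b w p + c * mean p) * exp_mass w =
  c * M * rsum (fun x => h x * expR (w x) * p x * m x).
Proof.
move=> dw Hw wmin p dp.
have [D [s1 [D0 s10 HD]]] := exp_mass_expand dw dp.
set A := rsum _ in HD *; set H := exp_mass w in Hw HD *.
set P := form b w p + c * mean p; set cM := c * M.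
have cM0 : 0 < cM by exact: mulr_gt0.
apply/eqP; rewrite -subr_eq0; apply/eqP.
have AD : 0 < 2 * (`|A| + D + 1) by rewrite mulr_gt0// ltr_wpDl// addr_ge0.
pose q := form b p p; have q0 : 0 <= q by exact: form_ge0.
(* the last term keeps the exponential mass of [w + s * p] positive *)
pose s0 := Num.min s1 (Num.min 1 (H / (2 * (`|A| + D + 1)))).
apply: (@first_order_zero _ _
  (`|P| * (`|A| + D) + q * (H + `|A| + D) + cM * D) s0).
  by rewrite !lt_min s10 ltr01 divr_gt0.
move=> s; rewrite !le_min => /and3P[ss1 s_1]; rewrite ler_pdivlMr// => sH.
have ds := form_domD bG m_gt0 s dw dp.
set v := fun x => w x + s * p x in ds.
have := HD s ss1; rewrite -/v; set Hv := exp_mass v => Hvr.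
have [r rE rD] : exists2 r, Hv = H + s * A + r & `|r| <= D * s ^+ 2.
  by exists (Hv - H - s * A) => //; ring.
have s2 : s ^+ 2 <= `|s|.
  by rewrite -real_normK ?num_real// expr2 ler_piMl.
have rs : `|r| <= D * `|s|.
  by apply: le_trans rD _; rewrite ler_wpM2l.
have sA : `|s * A| = `|s| * `|A| by rewrite normrM.
have Hv0 : 0 < Hv.
  have := ler_norm (- r); rewrite normrN; have := ler_norm (- (s * A)).
  by rewrite normrN rE; have := normr_ge0 s; nra.
have := wmin v ds Hv0.
rewrite /energy_functional (form_expand bG m_gt0 s dw dp) -/q.
have -> : mean v = mean w + s * mean p.
  rewrite /mean -(rsumZ _ (rsummable_mean dp)).
  rewrite -(rsumD (rsummable_mean dw) (rsummableZ s (rsummable_mean dp))).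
  by congr rsum; apply/funext => x; rewrite /v; ring.
rewrite -/H -/Hv -/cM.
have lnle : ln H - ln Hv <= H / Hv - 1.
  rewrite -ln_div ?posrE//.
  have := @le_ln1Dx R (H / Hv - 1).
  rewrite (_ : 1 + (H / Hv - 1) = H / Hv); last by ring.
  by apply; have := divr_gt0 Hw Hv0; lra.
have lnle' := ler_wpM2l (ltW cM0) lnle.
move=> wv.
have : 0 <= s * P + s ^+ 2 * q / 2 + cM * (H / Hv - 1).
  move: wv lnle'; rewrite /P.
  move: (form b w w) (form b w p) (mean w) (mean p) (ln H) (ln Hv) (H / Hv).
  by clearbody q cM; move=> ? ? ? ? ? ? ?; lra.
move/(mulr_ge0 (ltW Hv0)).
have -> : Hv * (s * P + s ^+ 2 * q / 2 + cM * (H / Hv - 1)) =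
    (s * P + s ^+ 2 * q / 2) * Hv + cM * (H - Hv).
  by field; rewrite gt_eqF.
move=> /le_trans; apply; rewrite rE.
apply: variation_bound => //; first exact: ltW.
by rewrite -rE ltW.
Qed.

(** The shift by [ln k] makes the exponential mass of [u] equal to [c * M], the
value for which the Euler-Lagrange equation of the shifted minimizer is the
equation to be solved. *)
Lemma solution_exists : exists2 u, form_dom b m u &
  ell2 m (fun x => h x * expR (u x) - c) /\
  forall p, form_dom b m p ->
    form b u p = inner m (fun x => h x * expR (u x) - c) p.
Proof.
have [w aw wmin] := minimizer_exists.
have [dw _ Hw] := aw.
have EL := euler_lagrange dw Hw (minimizer_global wmin).
have cM0 : 0 < c * M by exact: mulr_gt0.
pose k := c * M / exp_mass w; have k0 : 0 < k by exact: divr_gt0.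
pose u x := w x + ln k.
have du : form_dom b m u by exact: form_dom_shift.
have eu x : expR (u x) = k * expR (w x) by rewrite expRD lnK ?posrE// mulrC.
have [B B0 uB] := form_dom_bounded b_cc du.
exists u => //; split.
  apply/ell2P => //.
  have nh := (ell2P m_gt0 h).1 h2.
  have := rsummableD (rsummableZ (2 * expR B ^+ 2) nh)
                     (rsummableZ (2 * c ^+ 2) sm).
  apply: le_rsummable => x.
  rewrite ger0_norm; last by rewrite mulr_ge0 ?sqr_ge0 ?(ltW (m_gt0 x)).
  rewrite mulrA -mulrDl ler_wpM2r ?(ltW (m_gt0 x))//.
  have e1 : expR (u x) ^+ 2 <= expR B ^+ 2.
    rewrite lerXn2r ?nnegrE ?expR_ge0// ler_expR.
    exact: le_trans (ler_norm _) (uB x).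
  have := ler_wpM2l (sqr_ge0 (h x)) e1.
  have := sqr_ge0 (h x * expR (u x) + c).
  by move: (expR (u x)) (expR B) => e e'; lra.
move=> p dp; have [Bp Bp0 pB] := form_dom_bounded b_cc dp.
rewrite /u form_cst_l.
have -> : form b w p =
    k * rsum (fun x => h x * expR (w x) * p x * m x) - c * mean p.
  apply: (@mulIf _ (exp_mass w)); first by rewrite gt_eqF.
  have kH : k * exp_mass w = c * M by rewrite divfK// gt_eqF.
  by rewrite mulrBl [k * _ * _]mulrAC kH -EL//; ring.
have swp : rsummable (fun x => h x * expR (w x) * p x * m x).
  apply: le_rsummable (rsummableZ Bp (rsummable_norm (rsummable_exp dw))) => x.
  by rewrite mulrAC normrM mulrC ler_wpM2r.
have smp := rsummable_mean dp.
rewrite /inner /mean -(rsumZ _ swp) -(rsumZ _ smp).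
rewrite -(rsumB (rsummableZ k swp) (rsummableZ c smp)).
by congr rsum; apply/funext => x; rewrite -/(u x) eu; ring.
Qed.

End Functional.

(** * The theorem *)

Lemma positive_of_solution (R : realType) (X : countType) (b : X -> X -> R)
    (m : X -> R) (c : R) (h u : X -> R) (o : X) :
  is_graph b -> (forall x, 0 < m x) -> (total_mass m < +oo)%E -> 0 < c ->
  laplacian_rel b m u (fun x => h x * expR (u x) - c) ->
  exists x, 0 < h x.
Proof.
move=> bG m_gt0 m_fin c0 [du f2 uf]; apply: contrapT => /forallNP hneg.
have h0 x : h x <= 0 by rewrite leNgt; apply/negP; exact: hneg.
have sm := rsummable_mass m_gt0 m_fin.
have := uf _ (form_dom_cst bG m_gt0 m_fin 1).
rewrite /form [X in rsum X](_ : _ = fun=> 0); last first.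
  by apply/funext => p; rewrite subrr !mulr0.
rewrite rsum0 mulr0 /inner => E0.
have : rsum (fun x => (h x * expR (u x) - c) * 1 * m x) <=
    rsum (fun x => - c * m x).
  apply: ler_rsum; [|exact: rsummableZ|].
    have := ell2_rsummable m_gt0 m_fin f2.
    by under [X in rsummable X -> _]eq_fun do rewrite -[X in X * _]mulr1.
  move=> x; rewrite mulr1 ler_wpM2r ?(ltW (m_gt0 x))//.
  by have := expR_gt0 (u x); have := h0 x; nra.
rewrite -E0 (rsumZ _ sm).
have : m o <= rsum m by apply: (term_le_rsum o) => // x; exact: ltW.
by have := m_gt0 o; nra.
Qed.

Theorem theorem4p1 (R : realType) (X : countType) (b : X -> X -> R)
    (m : X -> R) (c : R) (h : X -> R) :
  is_graph b ->
  (forall x, 0 < m x) ->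
  (total_mass m < +oo)%E ->
  canonically_compactifiable b m ->
  0 < c ->
  ell2 m h ->
  h <> (fun=> 0) ->
  (exists2 u : X -> R, laplacian_dom b m u &
     laplacian b m u = (fun x => h x * expR (u x) - c))
  <-> (exists x, 0 < h x).
Proof.
move=> bG m_gt0 m_fin b_cc c_gt0 h2 hN0; split.
  move=> [u /laplacianP + uE]; rewrite uE => relu.
  have [x0 _] : exists x, h x <> 0.
    apply: contrapT => /forallNP h0; apply: hN0; apply/funext => x.
    by apply: contrapT; exact: h0.
  exact: positive_of_solution x0 bG m_gt0 m_fin c_gt0 relu.
move=> [x0 hx0].
have [u du [f2 uf]] := solution_exists bG m_gt0 m_fin b_cc c_gt0 h2 hx0.
have relu : laplacian_rel b m u (fun x => h x * expR (u x) - c) by [].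
have udom : laplacian_dom b m u by exists (fun x => h x * expR (u x) - c).
exists u => //.
exact: laplacian_rel_uniq bG m_gt0 (laplacianP udom) relu.
Qed.
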